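(* Let $0<p\le 1$ and let $(X,\|\cdot\|_p)$ be a finite-dimensional real complete $p$-normed space with $\dim X\ge 2$. Then for every $t\ge0$: (i) $\min\{1,t^p\}\,2^{p-1}\le S_p(t,X)\le (1+t)^p$; (ii) $|1-t|^p\le J_p(t,X)\le 1+t^p$.
   Context: A $p$-norm on a real vector space $X$ is a map $\|\cdot\|_p:X\to[0,\infty)$ such that (i) $\|x\|_p=0$ iff $x=0$; (ii) $\|\lambda x\|_p=|\lambda|^p\|x\|_p$ for all $\lambda\in\mathbb{R}$, $x\in X$; (iii) $\|x+y\|_p\le\|x\|_p+\|y\|_p$ for all $x,y\in X$. A (complete) $p$-normed space is a vector space with such a $p$-norm (complete for the metric $\|x-y\|_p$). $S_X=\{x\in X:\|x\|_p=1\}$. For $t\ge0$, $$J_p(t,X)=\sup\{\min\{\|x+ty\|_p,\|x-ty\|_p\}:x,y\in S_X\},$$ $$S_p(t,X)=\inf\{\max\{\|x+ty\|_p,\|x-ty\|_p\}:x,y\in S_X\}.$$ *)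

(* Defs.v *)
From HB Require Import structures.
From mathcomp Require Import all_boot all_order all_algebra.
From mathcomp Require Import all_classical all_reals all_analysis.
Set Implicit Arguments.
Unset Strict Implicit.
Unset Printing Implicit Defensive.
Import Order.TTheory GRing.Theory Num.Theory.
Local Open Scope classical_set_scope.
Local Open Scope ring_scope.

Record is_pnorm (R : realType) (X : lmodType R) (p : R) (N : X -> R) : Prop :=
  IsPnorm {
    pnorm_ge0 : forall x : X, 0 <= N x;
    pnorm_eq0 : forall x : X, N x = 0 <-> x = 0;
    pnormZ : forall (a : R) (x : X), N (a *: x) = `|a| `^ p * N x;
    ler_pnormD : forall x y : X, N (x + y) <= N x + N y
  }.

Definition pnorm_complete (R : realType) (X : lmodType R) (N : X -> R) : Prop :=
  forall u : nat -> X,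
    (forall e : R, 0 < e -> exists n0 : nat,
        forall m n : nat, (n0 <= m)%N -> (n0 <= n)%N -> N (u m - u n) < e) ->
    exists l : X, forall e : R, 0 < e -> exists n0 : nat,
        forall n : nat, (n0 <= n)%N -> N (u n - l) < e.

Definition unit_sphere (R : realType) (X : lmodType R) (N : X -> R) : set X :=
  [set x | N x = 1].

(* The exponent p enters Jp and Sp only through N.  The real-valued [sup] and
   [inf] are the genuine ones here: for a p-norm on a nonzero space and t >= 0
   both sets are nonempty and contained in [0, 1 + t `^ p]. *)
Definition Jp (R : realType) (X : lmodType R) (N : X -> R) (t : R) : R :=
  sup [set r | exists x y : X, [/\ unit_sphere N x, unit_sphere N y &
    r = Num.min (N (x + t *: y)) (N (x - t *: y))]].

Definition Sp (R : realType) (X : lmodType R) (N : X -> R) (t : R) : R :=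
  inf [set r | exists x y : X, [/\ unit_sphere N x, unit_sphere N y &
    r = Num.max (N (x + t *: y)) (N (x - t *: y))]].

(* Main.v *)
Require Import Defs.
From HB Require Import structures.
From mathcomp Require Import all_boot all_order all_algebra.
From mathcomp Require Import all_classical all_reals all_analysis.
Import Order.TTheory GRing.Theory Num.Theory.
Local Open Scope classical_set_scope.
Local Open Scope ring_scope.

(** The two bounds [Sp N t <= (1 + t) `^ p] and
    [`|1 - t| `^ p <= Jp N t] come from the degenerate pair [y = x] on the
    unit sphere: there [x + t *: y] and [x - t *: y] are the multiples of [x]
    by [1 + t] and [1 - t], and homogeneity gives both values exactly
    ([pnorm_scale_unit]).  Such an [x] exists because a nonzero vector can be
    normalized ([unit_sphere_nonempty]).

    The bound [Jp N t <= 1 + t `^ p] is the triangle inequality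
    ([pnormD_unit_le]).  The lower bound on [Sp N t] is the triangle inequality
    for the sum and for the difference of [x + t *: y] and [x - t *: y], which
    are [2 *: x] and [(2 * t) *: y]: the maximum of the two p-norms is at least
    half of [2 `^ p] and at least half of [2 `^ p * t `^ p]
    ([max_pnormDB_ge], [max_pnorm_unit_ge]). *)

Section PNorm.
Set Implicit Arguments.
Unset Strict Implicit.
Variables (R : realType) (X : lmodType R) (p : R) (N : X -> R).
Hypothesis hN : is_pnorm p N.

Lemma pnormN (x : X) : N (- x) = N x.
Proof. by rewrite -scaleN1r (pnormZ hN) normrN1 powR1 mul1r. Qed.

Lemma pnorm_scale_unit (a : R) (x : X) :
  unit_sphere N x -> N (a *: x) = `|a| `^ p.
Proof. by move=> Nx1; rewrite (pnormZ hN) Nx1 mulr1. Qed.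

(** Since [N] is homogeneous of degree [p], a nonzero vector is normalized by
    the factor [N v `^ (- p^-1)]. *)
Lemma unit_sphere_nonempty (v : X) :
  p != 0 -> v != 0 -> unit_sphere N !=set0.
Proof.
move=> p0 v0.
have Nv_neq0 : N v != 0 by apply: contra_neq v0 => /(pnorm_eq0 hN).
exists (N v `^ (- p^-1) *: v).
rewrite /unit_sphere /= (pnormZ hN) ger0_norm ?powR_ge0 // -powRrM.
by rewrite mulNr mulVf // powR_inv1 ?(pnorm_ge0 hN) // mulVf.
Qed.

Lemma pnormD_unit_le (t : R) (x y : X) : 0 <= t ->
  unit_sphere N x -> unit_sphere N y -> N (x + t *: y) <= 1 + t `^ p.
Proof.
move=> t0 Nx1 Ny1; apply: le_trans (ler_pnormD hN _ _) _.
by rewrite Nx1 (pnorm_scale_unit _ Ny1) ger0_norm.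
Qed.

(** The triangle inequality for [2 *: u = (u + w) + (u - w)]; exchanging [u]
    and [w] leaves the right-hand side unchanged, so the same bound serves both
    terms of the minimum in [max_pnorm_unit_ge]. *)
Lemma max_pnormDB_ge (u w : X) :
  2 `^ (p - 1) * N u <= Num.max (N (u + w)) (N (u - w)).
Proof.
have two_powR : 2 `^ p = 2 * 2 `^ (p - 1) :> R.
  by rewrite -[X in X * _]powRr1 // -powRD ?pnatr_eq0 ?implybT // addrC subrK.
have sum_le : 2 `^ p * N u <= N (u + w) + N (u - w).
  have -> : 2 `^ p * N u = N ((u + w) + (u - w)).
    by rewrite addrACA subrr addr0 -mulr2n -[u *+ 2]scaler_nat (pnormZ hN) normr_nat.
  exact: (ler_pnormD hN).
rewrite -(ler_pM2l (ltr0n R 2)) mulrA -two_powR.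
apply: le_trans sum_le _; rewrite mulr_natl mulr2n.
by apply: lerD; rewrite le_max lexx ?orbT.
Qed.

Lemma max_pnorm_unit_ge (t : R) (x y : X) : 0 <= t ->
  unit_sphere N x -> unit_sphere N y ->
  Num.min 1 (t `^ p) * 2 `^ (p - 1) <=
    Num.max (N (x + t *: y)) (N (x - t *: y)).
Proof.
move=> t0 Nx1 Ny1; rewrite mulrC /Num.min; case: ifP => _.
  by rewrite -[X in _ * X]Nx1; exact: max_pnormDB_ge.
have := max_pnormDB_ge (t *: y) x.
by rewrite (pnorm_scale_unit _ Ny1) ger0_norm // [t *: y + x]addrC
  -(pnormN (t *: y - x)) opprB.
Qed.

End PNorm.

Theorem proposition4p4 (R : realType) (p : R) (hp0 : 0 < p) (hp1 : p <= 1)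
    (X : vectType R) (hdim : (2 <= \dim {:X})%N)
    (N : X -> R) (hN : is_pnorm p N) (hcomplete : pnorm_complete N)
    (t : R) (ht : 0 <= t) :
  (Num.min 1 (t `^ p) * 2 `^ (p - 1) <= Sp N t <= (1 + t) `^ p) /\
  (`|1 - t| `^ p <= Jp N t <= 1 + t `^ p).
Proof.
have [x Nx1] : unit_sphere N !=set0.
  apply: (unit_sphere_nonempty hN (v := vpick {:X})); first by rewrite gt_eqF.
  by rewrite vpick0 -dimv_eq0 -lt0n (leq_trans _ hdim).
have NxD : N (x + t *: x) = (1 + t) `^ p.
  rewrite -{1}[x]scale1r -scalerDl (pnorm_scale_unit hN _ Nx1).
  by rewrite ger0_norm // addr_ge0.
have NxB : N (x - t *: x) = `|1 - t| `^ p.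
  by rewrite -{1}[x]scale1r -scalerBl (pnorm_scale_unit hN _ Nx1).
have NxB_le_NxD : N (x - t *: x) <= N (x + t *: x).
  rewrite NxB NxD ge0_ler_powR ?nnegrE ?addr_ge0 ?(ltW hp0) //.
  by rewrite (le_trans (ler_normB _ _)) // normr1 ger0_norm.
split; apply/andP; split.
- apply: lb_le_inf; first by exists (Num.max (N (x + t *: x)) (N (x - t *: x))), x, x.
  by move=> _ [u [v [Nu1 Nv1 ->]]]; exact: max_pnorm_unit_ge.
- rewrite -NxD -(max_l NxB_le_NxD); apply: ge_inf; last by exists x, x.
  exists 0 => _ [u [v [_ _ ->]]].
  by rewrite le_max (pnorm_ge0 hN).
- rewrite -NxB -(min_r NxB_le_NxD); apply: ub_le_sup; last by exists x, x.
  exists (1 + t `^ p) => _ [u [v [Nu1 Nv1 ->]]].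
  by rewrite ge_min (pnormD_unit_le hN).
- apply: ge_sup; first by exists (Num.min (N (x + t *: x)) (N (x - t *: x))), x, x.
  move=> _ [u [v [Nu1 Nv1 ->]]].
  by rewrite ge_min (pnormD_unit_le hN).
Qed.
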